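(* Let $m,n\ge1$ be integers and let $\alpha\in\mathbb{F}_q$. The number of monic $n$-smooth polynomials over $\mathbb{F}_q$ of the form $x^m+\alpha x^{m-1}+g(x)$, where $g\in\mathbb{F}_q[x]$ has degree at most $m-2$, is $$\sum_{l_1+2l_2+\cdots+nl_n=m}N^*\Big(m,\prod_{i=1}^nI_i^{l_i},\langle x+\alpha\rangle\Big)=q^{m-1}\sum_{(l_1,\dots,l_n)}\mathbf{1}\Big[\sum_{i=1}^n il_i=m\Big]\prod_{i=1}^n\binom{|I_i|+l_i-1}{l_i}q^{-il_i}$$ $$\qquad+\frac{v(\alpha)}{q}\sum_{(l_1,\dots,l_n)}\mathbf{1}\Big[\sum_{i=1}^n il_i=m\Big]\prod_{i=1}^nB_{l_i}(a_i,b_i),$$ where all sums run over tuples of integers $l_i\ge0$, $v(\alpha)=q\,\mathbf{1}[\alpha=0]-1$, and $N^*(m,\prod_{i=1}^nI_i^{l_i},\langle x+\alpha\rangle)$ denotes the number of monic polynomials of degree $m$ over $\mathbb{F}_q$ whose coefficient of $x^{m-1}$ is $\alpha$ and which have, for each $1\le i\le n$, exactly $l_i$ monic irreducible factors of degree $i$ counted with multiplicity.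
   Context: $\mathbb{F}_q$ is a finite field with $q=p^e$ elements, $p$ prime, $e\ge1$, and $I_i$ is the set of monic irreducible polynomials of degree $i$ over $\mathbb{F}_q$. A polynomial is $n$-smooth if all its irreducible factors have degree at most $n$. For $i\ge1$ put $$a_i=\frac{1}{iq}\sum_{k\mid i,\;p\nmid k}\mu(k)q^{i/k},\qquad b_i=\frac1i\sum_{k\mid i,\;p\mid k}\mu(k)q^{i/k},$$ with $\mu$ the Möbius function; these are integers ($b_i$ may be negative). For integers $k\ge 0$, $a,b$, put $$B_k(a,b)=\sum_{j=0}^{\lfloor k/p\rfloor}\binom{aq/p+j-1}{j}\binom{b+k-pj-1}{k-pj}\quad(b\ne0),\qquad B_k(a,0)=\binom{aq/p+k/p-1}{k/p}\,\mathbf{1}[p\mid k].$$ Binomial coefficients are generalized: $\binom{x}{n}=x(x-1)\cdots(x-n+1)/n!$ for integers $n\ge0$. $\mathbf{1}[P]$ is $1$ if $P$ is true and $0$ otherwise (and $B_k(a,0)=0$ when $p\nmid k$). The zero polynomial is allowed for $g$. *)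

(* Defs.v *)
From mathcomp Require Import all_boot all_order all_algebra.

Set Implicit Arguments.
Unset Strict Implicit.
Unset Printing Implicit Defensive.

Import Order.TTheory GRing.Theory Num.Theory.
Local Open Scope ring_scope.

Section Arithmetic.

(* Meaningful for n > 0. *)
Definition mobius (n : nat) : int :=
  if all (fun r => logn r n == 1%N) (primes n) then (-1) ^+ size (primes n)
  else 0.

Definition gbinom (x : rat) (n : nat) : rat :=
  (\prod_(i < n) (x - i%:R)) / n`!%:R.

Variables p q : nat.

Definition acoef (i : nat) : rat :=
  (i * q)%:R^-1 *
    \sum_(k <- divisors i | ~~ (p %| k)%N) (mobius k)%:~R * q%:R ^+ (i %/ k).

Definition bcoef (i : nat) : rat :=
  i%:R^-1 *
    \sum_(k <- divisors i | (p %| k)%N) (mobius k)%:~R * q%:R ^+ (i %/ k).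

(* The arguments a and b are rational numbers, so that acoef i and bcoef i,
   whose values are integers when q is a power of p, can be substituted. *)
Definition Bcoef (k : nat) (a b : rat) : rat :=
  if b == 0 then
    if (p %| k)%N then gbinom (a * q%:R / p%:R + (k %/ p)%:R - 1) (k %/ p)
    else 0
  else
    \sum_(0 <= j < (k %/ p).+1)
      gbinom (a * q%:R / p%:R + j%:R - 1) j *
      gbinom (b + (k - p * j)%:R - 1) (k - p * j).

End Arithmetic.

Section Factors.

Variable F : finFieldType.

(* Recall that {poly_n F} is the finite type of polynomials of size at most n,
   and that the size of a nonzero polynomial is its degree plus one. *)

Definition monic_irr (i : nat) : {set {poly_i.+1 F}} :=
  [set P : {poly_i.+1 F} |
    [&& size P == i.+1, (P : {poly F}) \is monic & irreducibleb P]].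

(* For nonzero f and nonconstant P, any k such that P ^+ k divides f is less
   than size f. *)
Definition multp (P f : {poly F}) : nat :=
  (\max_(k < size f | (P ^+ k %| f)%R) k)%N.

Definition irr_factors (i : nat) (f : {poly F}) : nat :=
  (\sum_(P in monic_irr i) multp (polyn P) f)%N.

(* For nonzero f; see smoothP. *)
Definition smooth (n : nat) (f : {poly F}) : bool :=
  [forall P : {poly_(size f) F},
    irreducibleb P && (polyn P %| f) ==> (size P <= n.+1)%N].

Lemma smoothP (n : nat) (f : {poly F}) : f != 0 ->
  reflect (forall P : {poly F},
             irreducible_poly P -> P %| f -> (size P <= n.+1)%N)
          (smooth n f).
Proof.
move=> nz_f; apply: (iffP forallP) => [sm P irrP dvdPf | sm P].
  have sP : (size P <= size f)%N by exact: dvdp_leq.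
  have eP := npolypK sP.
  have /implyP := sm (npolyp (size f) P); rewrite eP dvdPf andbT; apply.
  exact/irreducibleP.
by apply/implyP => /andP[/irreducibleP irrP]; exact: sm.
Qed.

Lemma multpP (P f : {poly F}) (k : nat) : f != 0 -> (1 < size P)%N ->
  (P ^+ k %| f) = (k <= multp P f)%N.
Proof.
move=> nz_f sP; have nzP : P != 0 by rewrite -size_poly_gt0 ltnW.
have bnd j : P ^+ j %| f -> (j < size f)%N.
  move/(dvdp_leq nz_f); apply: leq_trans.
  have: (0 < size (P ^+ j))%N by rewrite size_poly_gt0 expf_neq0.
  move/prednK <-; rewrite ltnS size_exp leq_pmull //.
  by rewrite -subn1 subn_gt0.
apply/idP/idP => [dvdk | lek].
  exact: (@bigop.leq_bigmax_cond _ _ (fun j : 'I_(size f) => j : nat)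
            (Ordinal (bnd k dvdk)) dvdk).
apply: dvdp_trans (dvdp_exp2l _ lek) _.
rewrite /multp.
by elim/big_ind: _ => [|x y px py|//]; rewrite ?expr0 ?dvd1p // /maxn; case: ifP.
Qed.

(* The number of monic n-smooth polynomials 'X^m + alpha 'X^(m-1) + g with
   g zero or of degree at most m - 2; for m = 1 this forces g = 0. *)
Definition smooth_count (m n : nat) (alpha : F) : nat :=
  #|[set f : {poly_m.+1 F} |
      [&& (f : {poly F}) \is monic, smooth n f
        & [exists g : {poly_m.-1 F},
             (f : {poly F}) ==
               'X^m + alpha *: 'X^(m.-1) + (g : {poly F})]]]|.

(* The index i : 'I_n stands for the degree i.+1. *)
Definition Nstar (m n : nat) (l : 'I_n -> nat) (alpha : F) : nat :=
  #|[set f : {poly_m.+1 F} |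
      [&& (f : {poly F}) \is monic, size f == m.+1, f`_(m.-1) == alpha
        & [forall i : 'I_n, irr_factors i.+1 f == l i]]]|.

Definition vchar (alpha : F) : rat := #|F|%:R * (alpha == 0)%:R - 1.

(* Tuples of nonnegative integers (l_1, ..., l_n) with l_1 + 2 l_2 + ... +
   n l_n = m; such a tuple has all its entries at most m. *)
Definition weight_tuples (m n : nat) : {set {ffun 'I_n -> 'I_m.+1}} :=
  [set l : {ffun 'I_n -> 'I_m.+1} | \sum_(i < n) i.+1 * l i == m]%N.

End Factors.

(* Main.v *)
(* Let psi be an additive character of F and write s(f) for the second leading
   coefficient of a monic f, so that s is additive on products. The number of
   monic f of a given factorization type l with s(f) = alpha is the average over
   psi of conj (psi alpha) H_psi(l), where H_psi(l) is the sum of psi(s(f)) over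
   the f of type l. Double counting the prime powers dividing such f shows
   that H_psi satisfies Newton's recurrence in each l_i, with power sums
   p_i(j), the sum of psi(s(P))^j over P in I_i; this determines H_psi. Running
   the same double counting over all monic polynomials gives
   \sum_(d | m) d p_d(m/d) = q^m for psi trivial and 0 otherwise, whence by
   Moebius inversion p_i(j) = |I_i| = q a_i + b_i for psi trivial, and
   p_i(j) = b_i + [p | j] q a_i otherwise. The coefficients binom(|I_i|+k-1, k)
   and B_k(a_i, b_i) satisfy the recurrences with these power sums, and the
   latter do not depend on psi, so that the average only involves the sum of
   conj (psi alpha) over nontrivial psi, which is v(alpha). *)

Require Import Defs.
From mathcomp Require Import all_boot all_order all_algebra.
From mathcomp Require Import all_fingroup all_field all_character ring.
Set Implicit Arguments.
Unset Strict Implicit.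
Unset Printing Implicit Defensive.
Import Order.TTheory GRing.Theory Num.Theory.
Local Open Scope ring_scope.

(** * Multiplicities, factor counts and smoothness of monic polynomials *)

Section FactorCounts.

Variable F : finFieldType.
Implicit Types (f g P Q : {poly F}) (i k m n : nat).

Lemma multp_eq P f k : f != 0 -> (1 < size P)%N ->
  (forall j, (P ^+ j %| f) = (j <= k)%N) -> multp P f = k.
Proof.
move=> nzf sP dvdE; apply/eqP; rewrite eqn_leq -dvdE multpP // leqnn /=.
by rewrite -multpP // dvdE.
Qed.

Lemma multp_factor P f : f != 0 -> irreducible_poly P ->
  exists2 g, f = P ^+ multp P f * g & ~~ (P %| g).
Proof.
move=> nzf irrP; have sP := irrP.1.
have /dvdpP[g fE] : P ^+ multp P f %| f by rewrite multpP.
exists g; first by rewrite mulrC.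
apply/negP => /dvdpP[h gE].
have : P ^+ (multp P f).+1 %| f.
  by rewrite [X in _ %| X]fE gE -mulrA -exprS dvdp_mulIr.
by rewrite multpP // ltnn.
Qed.

Lemma multpM P f g : f != 0 -> g != 0 -> irreducible_poly P ->
  multp P (f * g) = (multp P f + multp P g)%N.
Proof.
move=> nzf nzg irrP; have sP := irrP.1.
have nzP : P != 0 by rewrite -size_poly_gt0 ltnW.
have [f1 fE ndf] := multp_factor nzf irrP.
have [g1 gE ndg] := multp_factor nzg irrP.
have nd : ~~ (P %| f1 * g1) by rewrite Gauss_dvdpr ?irreducible_poly_coprime.
apply: multp_eq => [||j] //; first by rewrite mulf_neq0.
rewrite {1}fE {1}gE mulrACA -exprD.
have [le_j|lt_j] := leqP j; first by rewrite dvdp_mulr // dvdp_exp2l.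
apply/negP => /(dvdp_trans (dvdp_exp2l P lt_j)).
by rewrite exprSr dvdp_mul2l ?expf_neq0 // (negPf nd).
Qed.

Lemma multp_irr P Q : P \is monic -> Q \is monic ->
  irreducible_poly P -> irreducible_poly Q -> multp P Q = (P == Q).
Proof.
move=> mP mQ irrP irrQ; apply: multp_eq => [||j]; rewrite ?monic_neq0 ?irrP.1 //.
have eqPQ : (P %| Q) = (P == Q).
  apply/idP/eqP => [dvdPQ|->//]; apply/eqP; rewrite -eqp_monic //.
  by apply: irrQ.2 => //; have := irrP.1; case: (size P) => [|[]].
case: j => [|j]; first by rewrite expr0 dvd1p.
case: eqVneq => [<-|neqPQ] /=.
  by rewrite -{2}[P]expr1 dvdp_Pexp2l ?irrP.1.
apply/negP => /(dvdp_trans (dvdp_exp2l P (ltn0Sn j))).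
by rewrite expr1 eqPQ (negPf neqPQ).
Qed.

Lemma mem_monic_irr i (P : {poly_i.+1 F}) : P \in monic_irr F i ->
  [/\ size P = i.+1, (polyn P) \is monic & irreducible_poly P].
Proof. by rewrite inE => /and3P[/eqP sP mP /irreducibleP]. Qed.

Lemma irr_factorsM i f g : f != 0 -> g != 0 ->
  irr_factors i (f * g) = (irr_factors i f + irr_factors i g)%N.
Proof.
move=> nzf nzg; rewrite -big_split; apply: eq_bigr => P /mem_monic_irr[_ _ irrP].
exact: multpM.
Qed.

Lemma irr_factors_irr i Q : Q \is monic -> irreducible_poly Q ->
  irr_factors i Q = (size Q == i.+1).
Proof.
move=> mQ irrQ.
have multE (P : {poly_i.+1 F}) : P \in monic_irr F i ->
    multp P Q = (polyn P == Q).
  by case/mem_monic_irr => _ mP irrP; apply: multp_irr.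
rewrite /irr_factors (eq_bigr _ multE); case: eqP => [sQ|nsQ].
  have QK : polyn (npolyp i.+1 Q) = Q by rewrite npolypK ?sQ.
  rewrite (bigD1 (npolyp i.+1 Q)) ?inE ?QK ?sQ ?eqxx ?mQ /=; last exact/irreducibleP.
  rewrite big1 // => P /andP[_ neqP]; case: eqP => // PQ.
  by case/eqP: neqP; apply/val_inj; rewrite /= PQ QK.
by rewrite big1 // => P /mem_monic_irr[sP _ _]; case: eqP => // PQ; rewrite -PQ in nsQ.
Qed.

Lemma irr_factors1 i : irr_factors i (1 : {poly F}) = 0%N.
Proof.
have := @irr_factorsM i 1 1 (oner_neq0 _) (oner_neq0 _); rewrite mulr1 => /eqP.
by rewrite -{1}[irr_factors i 1]addn0 eqn_add2l eq_sym => /eqP.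
Qed.

Lemma irr_factorsX i f k : f != 0 ->
  irr_factors i (f ^+ k) = (k * irr_factors i f)%N.
Proof.
move=> nzf; elim: k => [|k IHk]; first by rewrite expr0 irr_factors1.
by rewrite exprS irr_factorsM ?expf_neq0 // IHk mulSn.
Qed.

Lemma monic_irr_factor f : f \is monic -> (1 < size f)%N ->
  exists P g, [/\ P \is monic, irreducible_poly P, g \is monic & f = P * g].
Proof.
elim: {f}_.+1 {-2}f (ltnSn (size f)) => // k IHk f lt_f mf sf.
have [irrf|] := boolP (irreducibleb f).
  by exists f, 1; rewrite monic1 mulr1; split=> //; apply/irreducibleP.
rewrite /irreducibleb sf /= => /forallPn[Q]; rewrite negb_imply -ltnNge.
rewrite -/(Pdiv.Ring.rdvdp _ _) -dvdpE => /andP[dvdQ sQ].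
have nzQ : polyn Q != 0 by rewrite -size_poly_gt0 ltnW.
pose u := lead_coef Q; have nzu : u != 0 by rewrite lead_coef_eq0.
pose Q1 : {poly F} := u^-1 *: polyn Q.
have mQ1 : Q1 \is monic by rewrite monicE lead_coefZ mulVf.
have /dvdpP[h fE] : Q1 %| f by rewrite dvdpZl ?invr_eq0.
have mh : h \is monic by rewrite -(monicMr h mQ1) -fE.
have sQ1 : size Q1 = size Q by rewrite size_scale ?invr_eq0.
have ltQ : (size Q < size f)%N.
  by apply: leq_ltn_trans (size_npoly Q) _; rewrite prednK // (ltn_trans _ sf).
have [] := IHk Q1; rewrite ?sQ1 //; first by apply: leq_trans ltQ _.
move=> P [g [mP irrP mg Q1E]]; exists P, (g * h).
by rewrite monicMl //; split=> //; rewrite mulrA -Q1E mulrC.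
Qed.

(** Stands in for unique factorization: quantities additive on products are controlled by their
    values at monic irreducibles. *)
Lemma monic_irr_ind (K : {poly F} -> Prop) :
  K 1 ->
  (forall P g, P \is monic -> irreducible_poly P -> g \is monic ->
     K g -> K (P * g)) ->
  forall f, f \is monic -> K f.
Proof.
move=> K1 KM f; elim: {f}_.+1 {-2}f (ltnSn (size f)) => // k IHk f lt_f mf.
have [sf|sf] := leqP (size f) 1.
  rewrite (_ : f = 1) //; move: mf; rewrite (size1_polyC sf) monicE lead_coefC.
  by move/eqP->.
have [P [g [mP irrP mg fE]]] := monic_irr_factor mf sf; rewrite fE.
apply: KM => //; apply: IHk => //; rewrite -ltnS; apply: leq_trans lt_f.
rewrite ltnS fE size_monicM ?monic_neq0 //; have := irrP.1.
by case: (size P) => [|[|s]] // _; rewrite addSn /= addSn ltnS leq_addl.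
Qed.

(** For monic [f], this is the degree of the [n]-smooth part of [f]. *)
Definition factor_weight n f := (\sum_(i < n) i.+1 * irr_factors i.+1 f)%N.

Lemma factor_weightM n f g : f != 0 -> g != 0 ->
  factor_weight n (f * g) = (factor_weight n f + factor_weight n g)%N.
Proof.
move=> nzf nzg; rewrite -big_split; apply: eq_bigr => i _ /=.
by rewrite irr_factorsM // mulnDr.
Qed.

Lemma factor_weight1 n : factor_weight n 1 = 0%N.
Proof. by rewrite /factor_weight big1 // => i _; rewrite irr_factors1 muln0. Qed.

Lemma factor_weight_irr n P : P \is monic -> irreducible_poly P ->
  factor_weight n P = if (size P <= n.+1)%N then (size P).-1 else 0%N.
Proof.
move=> mP irrP; have sP := irrP.1.
rewrite /factor_weight; under eq_bigr => i _ do rewrite irr_factors_irr //.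
case: leqP => [le_sn | lt_ns].
  have lt_i : ((size P).-2 < n)%N by case: (size P) sP le_sn => [|[|s]].
  have sPE : size P = (size P).-2.+2 by case: (size P) sP => [|[|s]].
  rewrite (bigD1 (Ordinal lt_i)) //= -sPE eqxx muln1 big1 ?addn0; last first.
    move=> i /eqP neqi; case: eqP => [sPi|]; last by rewrite muln0.
    by case: neqi; apply/val_inj; rewrite /= sPi.
  by case: (size P) sP => [|[|s]].
rewrite big1 // => i _; case: eqP => [sPi|]; last by rewrite muln0.
by rewrite sPi ltnS ltnNge ltn_ord in lt_ns.
Qed.

Lemma factor_weight_leq n f : f \is monic ->
  (factor_weight n f <= (size f).-1)%N.
Proof.
elim/monic_irr_ind => [|P g mP irrP mg IHg]; first by rewrite factor_weight1.
rewrite factor_weightM ?monic_neq0 // factor_weight_irr //.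
rewrite size_monicM ?monic_neq0 //.
have -> : (size P + size g).-1.-1 = ((size P).-1 + (size g).-1)%N.
  have := irrP.1; have := monic_neq0 mg; rewrite -size_poly_gt0.
  by case: (size P) (size g) => [|a] [|b] //; rewrite addnS.
by apply: leq_add => //; case: ifP.
Qed.

(** The smooth part exhausts [f] exactly when it has full degree. The induction removes one
    irreducible factor at a time. *)
Lemma smooth_factor_weight n f : f \is monic ->
  smooth n f = (factor_weight n f == (size f).-1).
Proof.
move=> mf; have nzf := monic_neq0 mf.
suff: (factor_weight n f == (size f).-1) <->
    (forall P : {poly F}, irreducible_poly P -> P %| f -> (size P <= n.+1)%N).
  by move=> eqf; apply/(smoothP _ nzf)/idP => /eqf.
move: f mf {nzf}; apply: monic_irr_ind => [|P g mP irrP mg IHg].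
  rewrite factor_weight1 size_poly1 eqxx; split=> // _ P irrP.
  rewrite dvdp1 => /eqP sP; by have := irrP.1; rewrite sP.
have nzP := monic_neq0 mP; have nzg := monic_neq0 mg.
rewrite factor_weightM // factor_weight_irr // size_monicM //.
have -> : (size P + size g).-1.-1 = ((size P).-1 + (size g).-1)%N.
  have := irrP.1; move: nzg; rewrite -size_poly_gt0.
  by case: (size P) (size g) => [|a] [|b] //; rewrite addnS.
have le_g := factor_weight_leq n mg; have sP := irrP.1.
case: leqP => [le_sP | lt_sP].
  rewrite eqn_add2l; split=> [/IHg smg Q irrQ|smPg].
    have [dvdQP _|ndQP] := boolP (Q %| P).
      by apply: leq_trans le_sP; apply: dvdp_leq.
    by rewrite Gauss_dvdpr ?irreducible_poly_coprime //; apply: smg.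
  by apply/IHg => Q irrQ dvdQg; apply: smPg => //; apply: dvdp_mull.
(* A factor [P] of degree above [n] makes both sides false: the weight of [g], at most its degree,
   cannot make up for the degree of [P], and [P] itself is a forbidden divisor. *)
split=> [/eqP eqw|/(_ P irrP (dvdp_mulIl _ _))]; last by rewrite leqNgt lt_sP.
move: le_g; rewrite add0n in eqw; rewrite eqw -subn_eq0 addnK.
by case: (size P) sP => [|[|s]].
Qed.

End FactorCounts.

(** * Additivity of the second leading coefficient *)

Section SubleadingCoef.

Variable F : finFieldType.
Implicit Types (f g P Q : {poly F}) (i k m n : nat).

(* The factor 'X gives constants the value 0, making the map additive on all
   monic polynomials. *)
Definition subcoef f : F := ('X * f)`_(size f).-1.

Lemma subcoef1 : subcoef 1 = 0.
Proof. by rewrite /subcoef size_poly1 coefXM. Qed.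

Lemma monic_split f : f \is monic ->
  exists2 f0, f = 'X^((size f).-1) + f0 & (size f0 <= (size f).-1)%N.
Proof.
move=> mf; exists (f - 'X^((size f).-1)); first by rewrite addrC subrK.
have sf : (size f).-1.+1 = size f by rewrite prednK // size_poly_gt0 monic_neq0.
apply/leq_sizeP => j le_j; rewrite coefB coefXn; case: eqVneq => [->|neqj].
  by have /monicP := mf; rewrite lead_coefE => ->; rewrite subrr.
by rewrite nth_default ?subr0 // -sf ltn_neqAle eq_sym neqj.
Qed.

Lemma subcoefM f g : f \is monic -> g \is monic ->
  subcoef (f * g) = subcoef f + subcoef g.
Proof.
move=> mf mg; rewrite /subcoef size_monicM ?monic_neq0 //.
have [f0 fE sf0] := monic_split mf; have [g0 gE sg0] := monic_split mg.
have -> : (size f + size g).-1.-1 = ((size f).-1 + (size g).-1)%N.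
  have := monic_neq0 mg; have := monic_neq0 mf; rewrite -!size_poly_gt0.
  by case: (size f) (size g) => [|a] [|b] //; rewrite addnS.
move: (size f).-1 (size g).-1 fE gE sf0 sg0 => m k -> -> sf0 sg0.
(* Only the two mixed terms reach degree [m + k]: the first term has degree [m + k + 1], and the
   last has size at most [m + k]. *)
have -> : 'X * (('X^m + f0) * ('X^k + g0)) =
    'X^((m + k).+1) + ('X * f0) * 'X^k + ('X * g0) * 'X^m + 'X * (f0 * g0).
  by rewrite exprS exprD; ring.
rewrite !mulrDr -!exprS !coefD !coefXn !coefMXn.
rewrite ltnNge leq_addl ltnNge leq_addr addnK addKn.
rewrite !(ltn_eqF (leqnn _.+1)) !add0r [X in _ + X]nth_default ?addr0 //.
rewrite mulrC; have [->|nz] := eqVneq (f0 * g0) 0; first by rewrite mul0r size_poly0.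
rewrite size_mulX //; have := size_mul_leq f0 g0; move: nz; rewrite -size_poly_gt0.
move=> s0 s1; apply: leq_ltn_trans s1 _; rewrite prednK; last first.
  by have := leq_trans s0 (size_mul_leq f0 g0); case: (_ + _)%N.
exact: leq_add.
Qed.

Lemma subcoefX f k : f \is monic -> subcoef (f ^+ k) = subcoef f *+ k.
Proof.
move=> mf; elim: k => [|k IHk]; first by rewrite expr0 subcoef1.
by rewrite exprS subcoefM ?monic_exp // IHk mulrS.
Qed.

End SubleadingCoef.

(* In terms of generating series, t * H' = (\sum_(j > 0) P j * t^j) * H. *)
Definition newton (R : pzSemiRingType) (P h : nat -> R) :=
  h 0 = 1 /\ forall k, k%:R * h k = \sum_(j < k) P j.+1 * h (k - j.+1)%N.

(** * Character sums over monic polynomials and over irreducibles *)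

Section CharacterSums.

Variables (F : finFieldType) (R : numFieldType) (psi : F -> R).
Hypothesis psi0 : psi 0 = 1.
Hypothesis psiD : {morph psi : x y / x + y >-> x * y}.
Implicit Types (f g P Q : {poly F}) (C : pred {poly F}) (i k m n N : nat).

Lemma psiX x k : psi (x *+ k) = psi x ^+ k.
Proof. by elim: k => [|k IHk] //; rewrite mulrS psiD IHk exprS. Qed.

(** [N] only bounds the ambient finite type; it is kept apart from the degree [m] so that sums of
    different degrees range over the same type. *)
Definition monic_sum N m C : R :=
  \sum_(f : {poly_N F} | [&& polyn f \is monic, size f == m.+1 & C f])
    psi (subcoef f).

(** The power sum of exponent [k] in the variables [psi (subcoef P)], to be fed into [newton]. *)
Definition irr_sum i k : R :=
  \sum_(P in monic_irr F i) psi (subcoef (polyn P)) ^+ k.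

(** The multiples of [Q] are reindexed by their cofactors, and [psi (subcoef _)] is multiplicative
    on monic polynomials. *)
Lemma monic_sum_shift N m k Q C C' : Q \is monic -> size Q = k.+1 ->
    (m + k < N)%N -> (forall g, g \is monic -> C (Q * g) = C' g) ->
  \sum_(f : {poly_N F} | [&& polyn f \is monic, size f == (m + k).+1 & C f]
                          && (Q %| f)) psi (subcoef f)
    = psi (subcoef Q) * monic_sum N m C'.
Proof.
move=> mQ sQ ltN CQ; have nzQ := monic_neq0 mQ.
have sQM g : g != 0 -> size (Q * g) = (k + size g)%N.
  by move=> nzg; rewrite size_monicM // sQ.
have le_div (f : {poly_N F}) : (size (polyn f %/ Q)%R <= N)%N.
  by rewrite (leq_trans (leq_divp _ _)) ?size_npoly.
rewrite (reindex_onto (fun g : {poly_N F} => npolyp N (Q * g))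
                      (fun f : {poly_N F} => npolyp N (polyn f %/ Q))) /=; last first.
  move=> f /andP[_ dvdQ]; apply/val_inj => /=.
  by rewrite (npolypK (le_div f)) mulrC divpK // npolypK // size_npoly.
rewrite mulr_sumr; set cond := BIG_P.
(* [npolyp] could truncate [Q * g]; it does not when [cond] holds, because [Q] divides the result
   with quotient [g]. *)
have fE (g : {poly_N F}) : cond g -> polyn (npolyp N (Q * g)) = Q * g.
  case/andP=> /andP[_ dvdQ] /eqP eg.
  by rewrite -{2}eg (npolypK (le_div _)) [RHS]mulrC divpK.
apply: eq_big => [g|g cg]; last first.
  move: (cg); rewrite /cond /= fE // => /andP[/andP[/and3P[mQg _ _] _] _].
  by rewrite subcoefM ?psiD // -(monicMl _ mQ).
apply/idP/idP => [cg|/and3P[mg /eqP sg Cg]].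
  move: (cg); rewrite /cond /= fE // => /andP[/andP[/and3P[mQg sQg CQg] _] _].
  have mg : polyn g \is monic by rewrite -(monicMl _ mQ).
  rewrite mg -CQ // CQg andbT.
  by move: sQg; rewrite sQM ?monic_neq0 // addnC -addSn eqn_add2r.
rewrite /cond /= npolypK; last by rewrite sQM ?monic_neq0 // sg addnS addnC.
rewrite monicMl // mg sQM ?monic_neq0 // sg addnS addnC eqxx CQ // Cg dvdp_mulIl /=.
by rewrite mulrC mulpK //; apply/eqP/val_inj; rewrite /= npolypK ?size_npoly.
Qed.

(** The multiplicity of [P] in [f] is the number of positive exponents [j] with [P ^+ j] dividing
    [f]; [k] is a common bound on these, so that the sums can be exchanged. *)
Lemma monic_sum_weight N m i C k :
    (forall f (P : {poly_i.+1 F}), P \in monic_irr F i -> f \is monic ->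
       size f = m.+1 -> C f -> (multp P f <= k)%N) ->
  \sum_(f : {poly_N F} | [&& polyn f \is monic, size f == m.+1 & C f])
      (irr_factors i f)%:R * psi (subcoef f)
    = \sum_(P in monic_irr F i) \sum_(j < k)
        \sum_(f : {poly_N F} | [&& polyn f \is monic, size f == m.+1 & C f]
                               && (polyn P ^+ j.+1 %| f)) psi (subcoef f).
Proof.
move=> le_k; under [RHS]eq_bigr => P _ do
  (under eq_bigr => j _ do rewrite big_mkcondr; rewrite exchange_big).
rewrite exchange_big; apply: eq_bigr => f /and3P[mf /eqP sf Cf].
rewrite natr_sum mulr_suml; apply: eq_bigr => P inP.
have sP : (1 < size P)%N by case: (mem_monic_irr inP) => _ _ [].
under eq_bigr => j _ do rewrite multpP ?monic_neq0 //.
rewrite -big_mkcond -(big_ord_widen k (fun=> psi (subcoef f)) (le_k _ _ _ _ _ _)) //.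
by rewrite sumr_const card_ord mulr_natl.
Qed.

Lemma size_monic_exp P d k : P \is monic -> size P = d.+1 ->
  size (P ^+ k) = (d * k).+1.
Proof.
move=> mP sP; have := size_exp P k; rewrite sP /= => <-.
by rewrite prednK // size_poly_gt0 monic_neq0 ?monic_exp.
Qed.

Lemma irr_factors_ge_multp i f (P : {poly_i.+1 F}) : P \in monic_irr F i ->
  (multp P f <= irr_factors i f)%N.
Proof. by move=> inP; rewrite /irr_factors (bigD1 P) //= leq_addr. Qed.

Lemma monic_size1 f : f \is monic -> size f = 1 -> f = 1.
Proof.
move=> mf sf; have fE : f = (f`_0)%:P by apply: size1_polyC; rewrite sf.
by move: mf; rewrite fE monicE lead_coefC => /eqP ->.
Qed.

Lemma monic_sum0 N C : (0 < N)%N -> monic_sum N 0 C = (C 1)%:R.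
Proof.
move=> N_gt0.
have oneK : polyn (npolyp N (1 : {poly F})) = 1 by rewrite npolypK ?size_poly1.
rewrite /monic_sum big_mkcond (bigD1 (npolyp N 1)) //= big1 ?addr0.
  by rewrite oneK monic1 size_poly1 eqxx /= subcoef1 psi0; case: (C 1).
move=> f nef; case: and3P => // -[mf /eqP sf _]; case/eqP: nef; apply/val_inj.
by rewrite /= oneK; apply: monic_size1.
Qed.

Definition has_type n (l : 'I_n -> nat) f :=
  [forall i : 'I_n, irr_factors i.+1 f == l i].

Definition type_degree n (l : 'I_n -> nat) := (\sum_(i < n) i.+1 * l i)%N.

(* Counting pairs of a prime power P ^+ j and a multiple of it gives the
   recurrence l_i H(l) = \sum_(j > 0) irr_sum i j * H(l - j e_i) for the sum H(l)
   over the polynomials of type l. *)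
Lemma type_sum_prod n (h : 'I_n -> nat -> R) N (l : 'I_n -> nat) :
    (forall i : 'I_n, newton (irr_sum i.+1) (h i)) ->
    (type_degree l < N)%N ->
  monic_sum N (type_degree l) (has_type l) = \prod_i h i (l i).
Proof.
move=> hP; elim: {l}_.+1 {-2}l (ltnSn (\sum_i l i)%N) => // s IHs l lt_s ltN.
have [/forallP l0|/forallPn[i nz_li]] := boolP [forall i, l i == 0%N].
  have d0 : type_degree l = 0%N.
    by rewrite /type_degree big1 // => i _; rewrite (eqP (l0 i)) muln0.
  rewrite d0 monic_sum0 ?(leq_trans _ ltN) // big1 => [|i _]; last first.
    by rewrite (eqP (l0 i)) (hP i).1.
  rewrite (_ : has_type l 1 = true) //; apply/forallP => i.
  by rewrite irr_factors1 eq_sym l0.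
(* The type of the cofactor once [P ^+ j.+1], with [P] of degree [i.+1], is divided out. *)
pose l' j (k : 'I_n) := if k == i then (l i - j.+1)%N else l k.
have l'_deg j : (j < l i)%N -> type_degree l = (type_degree (l' j) + i.+1 * j.+1)%N.
  move=> lt_j; rewrite /type_degree (bigD1 i) //= [in RHS](bigD1 i) //= /l' eqxx.
  rewrite addnAC -mulnDr subnK //; congr (_ + _)%N.
  by apply: eq_bigr => k /negPf ->.
have l'_sum j : (j < l i)%N -> (\sum_k l' j k < \sum_k l k)%N.
  move=> lt_j; rewrite (bigD1 i) //= [ltnRHS](bigD1 i) //= /l' eqxx.
  rewrite -addSn leq_add ?ltn_subrL ?lt0n ?nz_li //.
  by apply: leq_sum => k /negPf ->.
apply: (mulfI (x := (l i)%:R)); first by rewrite pnatr_eq0.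
have -> : (l i)%:R * monic_sum N (type_degree l) (has_type l) =
   \sum_(f : {poly_N F} | [&& polyn f \is monic,
       size f == (type_degree l).+1 & has_type l f])
      (irr_factors i.+1 f)%:R * psi (subcoef f).
  rewrite mulr_sumr; apply: eq_bigr => f /and3P[_ _ /forallP/(_ i)/eqP ->] //.
rewrite (@monic_sum_weight _ _ _ _ (l i)); last first.
  by move=> f P inP _ _ /forallP/(_ i)/eqP <-; apply: irr_factors_ge_multp.
rewrite (bigD1 i) //= mulrA (hP i).2 mulr_suml.
rewrite exchange_big; apply: eq_bigr => j _.
rewrite -mulrA mulr_suml; apply: eq_bigr => P inP.
have [sP mP irrP] := mem_monic_irr inP.
have mPj : polyn P ^+ j.+1 \is monic by rewrite monic_exp.
have lt_j := ltn_ord j.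
rewrite (l'_deg j lt_j) (@monic_sum_shift _ _ _ _ _ (has_type (l' j)) mPj).
- rewrite subcoefX // psiX; congr (_ * _).
  rewrite IHs.
  + rewrite (bigD1 i) //= /l' eqxx; congr (_ * _).
    by apply: eq_bigr => k /negPf ->.
  + exact: leq_trans (l'_sum j lt_j) _.
  + by apply: leq_ltn_trans ltN; rewrite (l'_deg j lt_j) leq_addr.
- exact: size_monic_exp.
- by rewrite -l'_deg.
move=> g mg; apply: eq_forallb => k.
rewrite irr_factorsM ?monic_neq0 // irr_factorsX ?monic_neq0 //.
rewrite irr_factors_irr // sP /l' eqSS.
case: (eqVneq k i) => [->|neki].
  by rewrite eqxx muln1 addnC -(eqn_add2r j.+1 _ (_ - _)) subnK.
by rewrite [_.+1 == _](_ : _ = false) ?muln0 //; apply/negbTE; rewrite eqSS eq_sym.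
Qed.

(** A divisor [d] amounts to a factorization of [k] into two factors. Their common range [m] does
    not depend on [k], which permits exchanging with a sum over [k]. *)
Lemma sum_divisors_pairs (G : nat -> nat -> R) k m : (0 < k <= m)%N ->
  \sum_(d <- divisors k) G d (k %/ d)%N =
  \sum_(d < m) \sum_(j < m | (d.+1 * j.+1 == k)%N) G d.+1 j.+1.
Proof.
case/andP=> k_gt0 le_km.
have -> : \sum_(d <- divisors k) G d (k %/ d)%N =
          \sum_(1 <= d < m.+1 | (d %| k)%N) G d (k %/ d)%N.
  rewrite -[RHS]big_filter; apply: perm_big; apply: uniq_perm.
  - exact: divisors_uniq.
  - by rewrite filter_uniq ?iota_uniq.
  move=> d; rewrite mem_filter mem_index_iota -dvdn_divisors // ltnS.
  case dvd_dk: (d %| k)%N => //=.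
  by rewrite (dvdn_gt0 k_gt0 dvd_dk) (leq_trans (dvdn_leq _ dvd_dk)).
rewrite big_add1 /= big_mkord big_mkcond; apply: eq_bigr => d _.
case: ifP => [/dvdnP[e kE]|ndvd]; last first.
  by rewrite big1 // => j /eqP kE; rewrite -kE dvdn_mulr in ndvd.
have e_gt0 : (0 < e)%N by move: k_gt0; rewrite kE; case: (e).
have lt_e : (e.-1 < m)%N by rewrite prednK // (leq_trans _ le_km) // kE leq_pmulr.
rewrite (bigD1 (Ordinal lt_e)) /= prednK // ?kE 1?mulnC // mulKn //.
rewrite big1 ?addr0 // => j /andP[/eqP eqj /eqP nej]; case: nej; apply/val_inj => /=.
by move/eqP: eqj; rewrite eqn_pmul2l // => /eqP <-.
Qed.

(** The coefficient of t^k in t L'/L, where L is the Euler product over monic irreducibles [P] of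
    1/(1 - psi(s(P)) t^(deg P)). *)
Definition irr_power_sum k : R :=
  \sum_(d <- divisors k) d%:R * irr_sum d (k %/ d).

(** This is t L' = (t L'/L) L, obtained by counting the prime powers dividing each [f], weighted by
    the degree of the prime. *)
Lemma newton_monic_sum N m : (m < N)%N ->
  m%:R * monic_sum N m xpredT =
    \sum_(k < m) irr_power_sum k.+1 * monic_sum N (m - k.+1) xpredT.
Proof.
move=> ltN.
have -> : m%:R * monic_sum N m xpredT = \sum_(d < m) d.+1%:R *
   \sum_(f : {poly_N F} | [&& polyn f \is monic, size f == m.+1 & xpredT (polyn f)])
      (irr_factors d.+1 f)%:R * psi (subcoef f).
  under eq_bigr => d _ do rewrite mulr_sumr.
  rewrite exchange_big mulr_sumr; apply: eq_bigr => f /and3P[mf /eqP sf _].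
  (* Every polynomial of degree [m] is [m]-smooth, so the factor [m] splits into the contributions
     of the degrees [d.+1]. *)
  have /eqP wE : factor_weight m (polyn f) == m.
    rewrite -{2}[m]/(m.+1.-1) -sf -smooth_factor_weight //.
    apply/smoothP; rewrite ?monic_neq0 // => P _ dvdP.
    by rewrite -sf dvdp_leq ?monic_neq0.
  rewrite -{1}wE natr_sum mulr_suml; apply: eq_bigr => d _.
  by rewrite natrM mulrA.
under [RHS]eq_bigr => k _ do
  rewrite /irr_power_sum (sum_divisors_pairs (fun d j => d%:R * irr_sum d j)
            (m := m)) ?ltn_ord // mulr_suml.
rewrite [RHS]exchange_big; apply: eq_bigr => d _.
rewrite (@monic_sum_weight N m d.+1 xpredT m); last first.
  move=> f P inP mf sf _; have [sP mP irrP] := mem_monic_irr inP.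
  have : polyn P ^+ multp P f %| f by rewrite multpP ?monic_neq0 ?irrP.1.
  move/(dvdp_leq (monic_neq0 mf)); rewrite sf (size_monic_exp _ mP sP) ltnS.
  by apply: leq_trans; rewrite leq_pmull.
under [RHS]eq_bigr => k _ do rewrite mulr_suml.
rewrite [RHS](exchange_big_dep xpredT) //= exchange_big mulr_sumr.
apply: eq_bigr => j _.
(* [P ^+ j.+1] has degree [d.+1 * j.+1]: either this is the single matching index [k.+1], or it
   exceeds [m] and both sides vanish. *)
have [le_m|lt_m] := leqP (d.+1 * j.+1) m.
  have lt_k : ((d.+1 * j.+1).-1 < m)%N by rewrite prednK ?muln_gt0.
  pose k0 := Ordinal lt_k.
  have k0E : k0.+1 = (d.+1 * j.+1)%N by rewrite prednK.
  rewrite (bigD1 k0) ?k0E // [X in _ = _ _ X]big1; last first.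
    move=> k /andP[/eqP eqk /eqP nek]; case: nek; apply/val_inj.
    by apply/eqP; rewrite -eqSS -eqk k0E.
  rewrite [RHS]addr0 -mulrA; congr (_ * _); rewrite mulr_suml; apply: eq_bigr => P inP.
  have [sP mP irrP] := mem_monic_irr inP.
  have mPj : polyn P ^+ j.+1 \is monic by rewrite monic_exp.
  have := @monic_sum_shift N (m - d.+1 * j.+1) _ _ xpredT xpredT mPj
    (size_monic_exp _ mP sP).
  by rewrite subnK // subcoefX // psiX => ->.
rewrite [RHS]big1 => [|k /eqP kE]; last by move: lt_m; rewrite kE ltnNge ltn_ord.
rewrite big1 ?mulr0 // => P inP; rewrite big1 // => f /andP[/and3P[mf /eqP sf _]].
have [sP mP irrP] := mem_monic_irr inP.
move/(dvdp_leq (monic_neq0 mf)).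
by rewrite sf (size_monic_exp _ mP sP) ltnS leqNgt lt_m.
Qed.

(** Translation by c X^(m-1) permutes the monic polynomials of degree [m] and multiplies every term
    by [psi c]. *)
Lemma monic_sum_nontrivial N m c : psi c != 1 -> (0 < m < N)%N ->
  monic_sum N m xpredT = 0.
Proof.
move=> psi_c /andP[m_gt0 ltN].
pose g : {poly F} := c *: 'X^(m.-1).
have sg : (size g < m.+1)%N.
  by rewrite ltnS (leq_trans (size_scale_leq _ _)) // size_polyXn prednK.
have gK : polyn (npolyp N g) = g by rewrite npolypK // (leq_trans (ltnW sg)).
have sD f s : s \in [:: g; - g] -> size f = m.+1 -> size (f + s) = m.+1.
  move=> sE sf; rewrite size_polyDl // sf.
  by case/orP: sE => [|/orP[|//]] /eqP ->; rewrite ?size_polyN.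
have mD f s : s \in [:: g; - g] -> size f = m.+1 -> f \is monic -> f + s \is monic.
  move=> sE sf; rewrite !monicE lead_coefDl // sf.
  by case/orP: sE => [|/orP[|//]] /eqP ->; rewrite ?size_polyN.
have eqM f : (f + g \is monic) && (size (f + g) == m.+1)
           = (f \is monic) && (size f == m.+1).
  apply/andP/andP => -[mf /eqP sf].
    have Ng : - g \in [:: g; - g] by rewrite !inE eqxx orbT.
    by have := mD _ _ Ng sf mf; have := sD _ _ Ng sf; rewrite addrK => -> ->.
  by rewrite mD ?sD ?inE ?eqxx.
suff : monic_sum N m xpredT = psi c * monic_sum N m xpredT.
  move/eqP; rewrite -{1}[monic_sum _ _ _]mul1r -subr_eq0 -mulrBl mulf_eq0 subr_eq0.
  by rewrite eq_sym (negPf psi_c) => /eqP.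
rewrite {1}/monic_sum (reindex_inj (addIr (npolyp N g))) mulr_sumr /=.
apply: eq_big => [f|f]; rewrite !andbT /= gK; first exact: eqM.
rewrite eqM => /andP[_ /eqP sf]; rewrite -psiD; congr psi.
rewrite /subcoef sD ?inE ?eqxx // sf /= mulrDr coefD [RHS]addrC; congr (_ + _).
by rewrite -scalerAr -exprS prednK // coefZ coefXn eqxx mulr1.
Qed.

(** Here L = 1: in the recurrence only the term with the monic sum of degree 0 survives. *)
Lemma irr_power_sum_nontrivial k c : psi c != 1 -> (0 < k)%N ->
  irr_power_sum k = 0.
Proof.
move=> psi_c; case: k => // k _; have := newton_monic_sum (ltnSn k.+1).
rewrite (monic_sum_nontrivial psi_c) ?ltnSn // mulr0 big_ord_recr /= subnn.
rewrite monic_sum0 // mulr1 big1 ?add0r // => j _.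
by rewrite (monic_sum_nontrivial psi_c) ?mulr0 // subn_gt0 ltnS ltn_ord ltnS leq_subr.
Qed.

End CharacterSums.

(** * The trivial character: counting all monic polynomials *)

Section TrivialCharacter.

Variables (F : finFieldType) (R : numFieldType).
Let one_char := fun _ : F => 1 : R.

Lemma card_monic N m : (m < N)%N ->
  #|[set f : {poly_N F} | (polyn f \is monic) && (size f == m.+1)]| = (#|F| ^ m)%N.
Proof.
move=> ltN; rewrite -card_npoly.
have sE (g : {poly_m F}) : size ('X^m + polyn g) = m.+1.
  by rewrite size_polyDl size_polyXn // ltnS size_npoly.
have gK (g : {poly_m F}) : polyn (npolyp N ('X^m + polyn g)) = 'X^m + polyn g.
  by rewrite npolypK // sE.
rewrite -(card_imset (f := fun g : {poly_m F} => npolyp N ('X^m + polyn g)) predT); last first.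
  move=> g g' /(congr1 (@polyn _ N)); rewrite !gK => /addrI eqg; exact/val_inj.
apply: eq_card => f; rewrite inE; apply/andP/imsetP => [[mf /eqP sf]|[g _ ->]].
  have [g fE sg] := monic_split mf; rewrite sf /= in fE sg.
  exists (npolyp m g) => //; apply/val_inj.
  by rewrite /= npolypK // npolypK -?fE ?sf.
by rewrite gK sE eqxx monicE lead_coefDl ?lead_coefXn // size_polyXn ltnS size_npoly.
Qed.

Lemma monic_sum_trivial N m : (m < N)%N ->
  monic_sum one_char N m xpredT = #|F|%:R ^+ m.
Proof.
move=> ltN; rewrite /monic_sum sumr_const -natrX -(card_monic ltN); congr _%:R.
by apply: eq_card => f; rewrite [in RHS]inE unfold_in andbT.
Qed.

Lemma irr_sum_trivial i k : irr_sum one_char i k = #|monic_irr F i|%:R.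
Proof. by rewrite /irr_sum (eq_bigr (fun=> 1)) ?sumr_const // => P _; rewrite expr1n. Qed.

(** Here L = 1/(1 - qt). By induction every earlier term of the recurrence equals q^k, so the last
    one does too. *)
Lemma irr_power_sum_trivial k : (0 < k)%N -> irr_power_sum one_char k = #|F|%:R ^+ k.
Proof.
elim/ltn_ind: k => -[//|k] IHk _.
have psiD : {morph one_char : x y / x + y >-> x * y} by move=> x y; rewrite mulr1.
have := newton_monic_sum (erefl _) psiD (ltnSn k.+1).
rewrite monic_sum_trivial // big_ord_recr /= subnn.
rewrite monic_sum_trivial // mulr1 (eq_bigr (fun=> #|F|%:R ^+ k.+1)) => [|j _].
  by rewrite sumr_const card_ord mulr_natl mulrSr => /addrI/esym.
have lt_j : (j.+1 < k.+1)%N by rewrite ltnS.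
by rewrite IHk // monic_sum_trivial ?ltnS ?leq_subr // -exprD subnKC // ltnW.
Qed.

End TrivialCharacter.

(** * Rearranging sums over divisors *)

Section DivisorSums.

Variable V : nmodType.
Implicit Types (H : nat -> V) (d k m p : nat).

Lemma eq_big_divisors m (C C' : pred nat) H : (0 < m)%N ->
    (forall d, (d %| m)%N -> C d = C' d) ->
  \sum_(d <- divisors m | C d) H d = \sum_(d <- divisors m | C' d) H d.
Proof.
move=> m_gt0 eqC; rewrite big_seq_cond [RHS]big_seq_cond; apply: eq_bigl => d.
by rewrite -dvdn_divisors //; case: (boolP (d %| m)%N) => // /eqC ->.
Qed.

Lemma eq_big_divisorsr m (C : pred nat) H H' : (0 < m)%N ->
    (forall d, (d %| m)%N -> C d -> H d = H' d) ->
  \sum_(d <- divisors m | C d) H d = \sum_(d <- divisors m | C d) H' d.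
Proof.
move=> m_gt0 eqH; rewrite big_seq_cond [RHS]big_seq_cond; apply: eq_bigr => d.
by rewrite -dvdn_divisors // => /andP[/eqH]; exact.
Qed.

Lemma sum_divisors_dvd d m H : (0 < m)%N -> (d %| m)%N ->
  \sum_(k <- divisors d) H k = \sum_(k <- divisors m | (k %| d)%N) H k.
Proof.
move=> m_gt0 dvd_dm; rewrite -[RHS]big_filter; apply: perm_big.
have d_gt0 := dvdn_gt0 m_gt0 dvd_dm.
apply: uniq_perm => [||k]; rewrite ?filter_uniq ?divisors_uniq //.
rewrite mem_filter -!dvdn_divisors //.
by case: (boolP (k %| d)%N) => // /dvdn_trans ->.
Qed.

Lemma sum_divisors_mul d m H : (0 < m)%N -> (d %| m)%N ->
  \sum_(k <- divisors m | (d %| k)%N) H k =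
  \sum_(e <- divisors (m %/ d)) H (d * e)%N.
Proof.
move=> m_gt0 /dvdnP[c mE]; move: m_gt0; rewrite {}mE muln_gt0 => /andP[c_gt0 d_gt0].
rewrite mulnK // -big_filter -[RHS](big_map (muln d) xpredT); apply: perm_big.
apply: uniq_perm => [||k].
- by rewrite filter_uniq ?divisors_uniq.
- rewrite map_inj_uniq ?divisors_uniq // => x y /eqP.
  by rewrite eqn_pmul2l // => /eqP.
rewrite mem_filter -dvdn_divisors ?muln_gt0 ?c_gt0 //.
apply/andP/mapP => [[/dvdnP[x ->]]|[x + ->]].
  by rewrite dvdn_pmul2r // => dvd_x; exists x; rewrite 1?mulnC // -dvdn_divisors.
by rewrite -dvdn_divisors // dvdn_mulr // [(c * d)%N]mulnC dvdn_pmul2l.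
Qed.

Lemma sum_divisors_cofactor p m H : (0 < m)%N -> (0 < p)%N ->
  \sum_(d <- divisors m | (p %| m %/ d)%N) H d =
  if (p %| m)%N then \sum_(d <- divisors (m %/ p)) H d else 0.
Proof.
move=> m_gt0 p_gt0; case: ifP => [dvd_pm|ndvd_pm]; last first.
  rewrite big_seq_cond big1 // => d; rewrite -dvdn_divisors // => /andP[dvd_dm].
  by move=> /dvdn_trans/(_ (dvdn_div dvd_dm)); rewrite ndvd_pm.
rewrite (@sum_divisors_dvd _ m) ?dvdn_div //; apply: eq_big_divisors => // d dvd_dm.
by rewrite !dvdn_divRL // mulnC.
Qed.

(** With [d] = k e, both sides run over the pairs (k, e) whose product divides [m]. *)
Lemma sum_divisors_swap m (K : nat -> nat -> V) : (0 < m)%N ->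
  \sum_(d <- divisors m) \sum_(k <- divisors d) K k (d %/ k)%N =
  \sum_(e <- divisors m) \sum_(k <- divisors (m %/ e)) K k e.
Proof.
move=> m_gt0.
transitivity (\sum_(k <- divisors m) \sum_(e <- divisors (m %/ k)) K k e).
  rewrite (@eq_big_divisorsr _ _ _ (fun d =>
    \sum_(k <- divisors m | (k %| d)%N) K k (d %/ k)%N)) //; last first.
    by move=> d dvd_dm _; rewrite (sum_divisors_dvd _ m_gt0 dvd_dm).
  rewrite (exchange_big_dep xpredT) //=.
  apply: eq_big_divisorsr => // k dvd_km _; have k_gt0 := dvdn_gt0 m_gt0 dvd_km.
  rewrite (sum_divisors_mul (fun d => K k (d %/ k)%N) m_gt0 dvd_km).
  by apply: eq_bigr => e _; rewrite mulKn.
rewrite (@eq_big_divisorsr _ _ _ (fun k =>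
   \sum_(e <- divisors m | (k * e %| m)%N) K k e)) //; last first.
  move=> k dvd_km _; rewrite (@sum_divisors_dvd _ m) ?dvdn_div //.
  by apply: eq_bigl => e; rewrite dvdn_divRL // mulnC.
rewrite (exchange_big_dep xpredT) //=; apply: eq_big_divisorsr => // e dvd_em _.
rewrite [RHS](@sum_divisors_dvd _ m) ?dvdn_div //.
by apply: eq_bigl => k; rewrite dvdn_divRL.
Qed.

End DivisorSums.

(** Uniqueness in Moebius inversion: strong induction cancels the proper divisors. *)
Lemma divisor_sum_inj (V : zmodType) (X Y : nat -> V) :
    (forall m, (0 < m)%N -> \sum_(d <- divisors m) X d = \sum_(d <- divisors m) Y d) ->
  forall m, (0 < m)%N -> X m = Y m.
Proof.
move=> eqXY; elim/ltn_ind => m IHm m_gt0; have := eqXY m m_gt0.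
have m_in : m \in divisors m by rewrite -dvdn_divisors.
rewrite (big_rem m m_in) [X in _ = X](big_rem m m_in) /=.
rewrite (@eq_big_seq _ _ _ _ _ X Y) => [/addIr //|d].
rewrite mem_rem_uniq ?divisors_uniq // inE -dvdn_divisors // => /andP[neq_d dvd_dm].
by rewrite IHm ?(dvdn_gt0 m_gt0) // ltn_neqAle neq_d dvdn_leq.
Qed.

(** * Sums of the Moebius function *)

Section Mobius.

Variable p : nat.
Hypothesis p_pr : prime p.

Lemma mobius_mul_prime k : (0 < k)%N ->
  mobius (p * k) = if (p %| k)%N then 0 else - mobius k.
Proof.
move=> k_gt0; have p_gt0 := prime_gt0 p_pr; rewrite /mobius.
case: (boolP (p %| k)%N) => [dvd_pk|ndvd_pk].
  case: ifP => // /allP/(_ p); rewrite mem_primes p_pr muln_gt0 p_gt0 k_gt0.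
  rewrite dvdn_mulr // => /(_ isT); rewrite lognM // lognE p_pr p_gt0 dvdnn.
  rewrite divnn p_gt0 logn1 add1n eqSS -leqn0 leqNgt logn_gt0 mem_primes.
  by rewrite p_pr k_gt0 dvd_pk.
have pp : perm_eq (primes (p * k)) (p :: primes k).
  apply: uniq_perm => [||r] /=; rewrite ?primes_uniq ?andbT //.
    by rewrite mem_primes k_gt0 p_pr.
  by rewrite primesM // primes_prime // !inE.
rewrite (perm_all _ pp) (perm_size pp) /= exprS mulN1r.
rewrite lognM // logn_prime // eqxx lognE p_pr k_gt0 (negPf ndvd_pk) /=.
rewrite (@eq_in_all _ _ (fun r => logn r k == 1%N)) => [|r].
  by case: ifP; rewrite ?oppr0.
rewrite mem_primes => /and3P[r_pr _ dvd_rk]; rewrite lognM // logn_prime //.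
by case: (eqVneq r p) => [rp|//]; rewrite -rp dvd_rk in ndvd_pk.
Qed.

Lemma sum_mobius_multiples m : (0 < m)%N ->
  \sum_(k <- divisors m | (p %| k)%N) mobius k =
  if (p %| m)%N then - \sum_(k <- divisors (m %/ p) | ~~ (p %| k)%N) mobius k else 0.
Proof.
move=> m_gt0; have p_gt0 := prime_gt0 p_pr.
case: ifP => [dvd_pm|ndvd_pm].
  rewrite sum_divisors_mul // -sumrN [RHS]big_mkcond.
  apply: eq_big_divisorsr => [|k dvd_k _]; first by rewrite divn_gt0 // dvdn_leq.
  rewrite mobius_mul_prime; last by apply: dvdn_gt0 dvd_k; rewrite divn_gt0 // dvdn_leq.
  by case: ifP.
rewrite big_seq_cond big1 // => k; rewrite -dvdn_divisors // => /andP[dvd_km dvd_pk].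
by rewrite (dvdn_trans dvd_pk dvd_km) in ndvd_pm.
Qed.

End Mobius.

(** For a prime p dividing [m], the divisors divisible by p cancel the others, since a divisor of
    [m] prime to p already divides m/p. *)
Lemma sum_mobius m : (0 < m)%N ->
  \sum_(k <- divisors m) mobius k = (m == 1%N)%:R.
Proof.
move=> m_gt0; have [m1|m_neq1] := eqVneq m 1%N; first by rewrite m1 big_seq1.
have m_gt1 : (1 < m)%N by rewrite ltn_neqAle eq_sym m_neq1.
have p_pr := pdiv_prime m_gt1; have dvd_pm := pdiv_dvd m.
rewrite (bigID (fun k => pdiv m %| k)%N) /= sum_mobius_multiples // dvd_pm.
rewrite (_ : _%:R = 0) //; apply/eqP; rewrite addrC subr_eq0 eq_sym; apply/eqP.
rewrite big_mkcond (sum_divisors_dvd _ m_gt0 (dvdn_div dvd_pm)) -big_mkcondr /=.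
apply: eq_big_divisors => // d dvd_dm; case: (boolP (_ %| d)%N) => [|ndvd_pd].
  by rewrite andbF.
rewrite andbT -(@Gauss_dvdl _ _ (pdiv m)) ?divnK //.
by rewrite coprime_sym prime_coprime.
Qed.

(** * Divisor sums of the coefficients a_d and b_d *)

Section CoefficientSums.

Variables (p q : nat).
Hypotheses (p_pr : prime p) (q_gt0 : (0 < q)%N).

Let summand d k : rat := (mobius k)%:~R * q%:R ^+ (d %/ k).

Lemma acoefE d : (0 < d)%N ->
  d%:R * (q%:R * acoef p q d) = \sum_(k <- divisors d | ~~ (p %| k)%N) summand d k.
Proof.
move=> d_gt0; rewrite /acoef mulrA -natrM mulrA mulfV ?mul1r //.
by rewrite pnatr_eq0 -lt0n muln_gt0 d_gt0.
Qed.

Lemma bcoefE d : (0 < d)%N ->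
  d%:R * bcoef p q d = \sum_(k <- divisors d | (p %| k)%N) summand d k.
Proof. by move=> d_gt0; rewrite /bcoef mulrA mulfV ?mul1r // pnatr_eq0 -lt0n. Qed.

(** Together the two coefficients contain the full Moebius sum, so after the swap [sum_mobius]
    leaves only the term of [m]. *)
Lemma sum_abcoef m : (0 < m)%N ->
  \sum_(d <- divisors m) d%:R * (q%:R * acoef p q d + bcoef p q d) = q%:R ^+ m.
Proof.
move=> m_gt0.
rewrite (@eq_big_divisorsr _ _ _ _ (fun d => \sum_(k <- divisors d) summand d k)) //; last first.
  move=> d dvd_dm _; have d_gt0 := dvdn_gt0 m_gt0 dvd_dm.
  by rewrite [RHS](bigID (fun k => p %| k)%N) /= mulrDr acoefE // bcoefE // addrC.
rewrite (sum_divisors_swap (fun k e => (mobius k)%:~R * q%:R ^+ e)) //.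
rewrite (@eq_big_divisorsr _ _ _ _ (fun e => (m %/ e == 1)%N%:R * q%:R ^+ e)) //; last first.
  move=> e dvd_em _; rewrite -mulr_suml -rmorph_sum /= sum_mobius //.
    by rewrite mulrz_nat.
  by rewrite divn_gt0 ?(dvdn_leq m_gt0) // (dvdn_gt0 m_gt0 dvd_em).
have m_in : m \in divisors m by rewrite -dvdn_divisors.
rewrite (big_rem m m_in) /= divnn m_gt0 mul1r big1_seq ?addr0 // => e.
rewrite mem_rem_uniq ?divisors_uniq // inE -dvdn_divisors // => /and3P[_ neq_e dvd_em].
case: eqP => [m_e|]; last by rewrite mul0r.
by rewrite -(divnK dvd_em) m_e mul1n eqxx in neq_e.
Qed.

(** After the swap, [sum_mobius_multiples] turns the part from b into minus a sum over [m %/ p] of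
    Moebius values at integers prime to [p]; this is the part from a, restricted to divisors of
    [m %/ p]. *)
Lemma sum_bcoef m : (0 < m)%N ->
  \sum_(d <- divisors m)
    d%:R * (bcoef p q d + (p %| m %/ d)%N%:R * (q%:R * acoef p q d)) = 0.
Proof.
move=> m_gt0; have p_gt0 := prime_gt0 p_pr.
rewrite (eq_bigr (fun d => d%:R * bcoef p q d +
  (if (p %| m %/ d)%N then d%:R * (q%:R * acoef p q d) else 0))) => [|d _]; last first.
  by rewrite mulrDr; case: ifP => _; rewrite ?mul1r // mul0r mulr0.
rewrite big_split /= -big_mkcond sum_divisors_cofactor //=.
(* The common shape of both parts after the swap, with [C] selecting the Moebius values. *)
pose G (C : pred nat) m' : rat := \sum_(e <- divisors m') q%:R ^+ e *
   (\sum_(k <- divisors (m' %/ e) | C k) mobius k)%:~R.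
have swapE (C : pred nat) m' : (0 < m')%N ->
    \sum_(d <- divisors m') \sum_(k <- divisors d | C k) summand d k = G C m'.
  move=> m'_gt0; under eq_bigr => d _ do rewrite big_mkcond.
  rewrite (sum_divisors_swap (fun k e => if C k then (mobius k)%:~R * q%:R ^+ e else 0)) //.
  apply: eq_bigr => e _; rewrite -big_mkcond /= rmorph_sum mulr_sumr.
  by apply: eq_bigr => k _; rewrite mulrC.
have -> : \sum_(d <- divisors m) d%:R * bcoef p q d = G (fun k => p %| k)%N m.
  rewrite -swapE //; apply: eq_big_divisorsr => // d dvd_dm _.
  by rewrite bcoefE // (dvdn_gt0 m_gt0).
have GE : G (fun k => p %| k)%N m = - \sum_(e <- divisors m | (p %| m %/ e)%N)
    q%:R ^+ e * (\sum_(k <- divisors (m %/ e %/ p) | ~~ (p %| k)%N) mobius k)%:~R.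
  rewrite [X in - X]big_mkcond -sumrN; apply: eq_big_divisorsr => // e dvd_em _.
  rewrite sum_mobius_multiples //; last first.
    by rewrite divn_gt0 ?(dvdn_leq m_gt0) // (dvdn_gt0 m_gt0 dvd_em).
  by case: ifP => _; rewrite ?mulr0 ?oppr0 // rmorphN mulrN.
rewrite GE sum_divisors_cofactor //; case: ifP => [dvd_pm|_]; last by rewrite oppr0 addr0.
have mp_gt0 : (0 < m %/ p)%N by rewrite divn_gt0 // dvdn_leq.
apply/eqP; rewrite addrC subr_eq0; apply/eqP.
transitivity (G (fun k => ~~ (p %| k)%N) (m %/ p)%N).
  rewrite -swapE //; apply: eq_big_divisorsr => // d dvd_dm _.
  by rewrite acoefE // (dvdn_gt0 mp_gt0).
by apply: eq_bigr => e _; rewrite -!divnMA mulnC.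
Qed.

End CoefficientSums.

(** * Newton recurrences for binomial coefficients and for B_k *)

Section NewtonRecurrences.

Implicit Types (a b x : rat) (j k p q : nat).

(** Logarithmic derivatives add under products of generating series. The series are truncated to
    polynomials, which is harmless for the coefficient of index [k]. *)
Lemma newton_conv (R : comNzRingType) (P Q u v : nat -> R) :
    newton P u -> newton Q v ->
  newton (fun j => P j + Q j) (fun k => \sum_(i < k.+1) u i * v (k - i)%N).
Proof.
move=> [u0 uE] [v0 vE]; split=> [|k]; first by rewrite big_ord1 u0 v0 mulr1.
pose trunc (w : nat -> R) := \poly_(i < k.+1) w i.
(* Power sum series start in degree 1, as in [newton]. *)
pose gen (w : nat -> R) := trunc (fun i => if i is 0%N then 0 else w i).
have convE w w' j : (j <= k)%N ->
    (trunc w * trunc w')`_j = \sum_(i < j.+1) w i * w' (j - i)%N.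
  move=> le_jk; rewrite coefM; apply: eq_bigr => i _; rewrite !coef_poly.
  by rewrite !ltnS (leq_trans _ le_jk) ?(leq_trans (leq_subr _ _) le_jk) // -ltnS.
have genE W w j : (j <= k)%N ->
    (gen W * trunc w)`_j = \sum_(i < j) W i.+1 * w (j - i.+1)%N.
  by move=> le_jk; rewrite convE // big_ord_recl mul0r add0r.
have derivE W w : (forall j, j%:R * w j = \sum_(i < j) W i.+1 * w (j - i.+1)%N) ->
    forall j, (j <= k)%N -> ('X * (trunc w)^`())`_j = (gen W * trunc w)`_j.
  move=> wE j le_jk; rewrite genE // -wE coefXM; case: j le_jk => [|j] le_jk /=.
    by rewrite mul0r.
  by rewrite coef_deriv coef_poly ltnS le_jk mulr_natl.
have eq_coefM (A A' B : {poly R}) : (forall j, (j <= k)%N -> A`_j = A'`_j) ->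
    (A * B)`_k = (A' * B)`_k.
  by move=> eqA; rewrite !coefM; apply: eq_bigr => i _; rewrite eqA // -ltnS.
transitivity (('X * (trunc u * trunc v)^`())`_k).
  rewrite -convE // coefXM; case: (k) => [|k'] /=; first by rewrite mul0r.
  by rewrite coef_deriv mulr_natl.
rewrite derivM mulrDr mulrA [trunc u * _]mulrC mulrA coefD.
rewrite (eq_coefM _ _ _ (derivE _ _ uE)) (eq_coefM _ _ _ (derivE _ _ vE)).
rewrite -!mulrA [trunc v * _]mulrC -coefD -mulrDl coefM.
rewrite big_ord_recl !coefD !coef_poly addr0 mul0r add0r.
apply: eq_bigr => i _; rewrite convE ?leq_subr // !coefD !coef_poly /= /bump /= add1n.
by rewrite ltnS ltn_ord.
Qed.

Lemma newton_eq (R : pzSemiRingType) (P P' h h' : nat -> R) :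
  P =1 P' -> h =1 h' -> newton P h -> newton P' h'.
Proof.
move=> eqP eqh [h0 hE]; split=> [|k]; first by rewrite -eqh.
by rewrite -eqh hE; apply: eq_bigr => j _; rewrite eqP eqh.
Qed.

Lemma newton_morph (R S : pzSemiRingType) (f : {rmorphism R -> S}) P h :
  newton P h -> newton (f \o P) (f \o h).
Proof.
move=> [h0 hE]; split=> [|k]; first by rewrite /= h0 rmorph1.
rewrite -[k%:R](rmorph_nat f) -rmorphM hE rmorph_sum.
by apply: eq_bigr => j _; rewrite rmorphM.
Qed.

(** The coefficient of t^k in (1 - t)^(-x). *)
Definition multichoose x k := gbinom (x + k%:R - 1) k.

Lemma multichooseE x k : multichoose x k = (\prod_(i < k) (x + i%:R)) / k`!%:R.
Proof.
congr (_ / _); rewrite (reindex_inj rev_ord_inj); apply: eq_bigr => i _ /=.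
by rewrite natrB // -[i.+1%:R]natr1; ring.
Qed.

Lemma multichoose0 x : multichoose x 0 = 1.
Proof. by rewrite multichooseE big_ord0 divr1. Qed.

Lemma multichooseS x k :
  k.+1%:R * multichoose x k.+1 = (x + k%:R) * multichoose x k.
Proof.
rewrite !multichooseE big_ord_recr factS natrM /=; field.
by rewrite nat1r !pnatr_eq0 -lt0n fact_gt0.
Qed.

Lemma multichoose0S k : multichoose 0 k.+1 = 0.
Proof. by rewrite multichooseE big_ord_recl /= addr0 !mul0r. Qed.

Lemma newton_multichoose x : newton (fun=> x) (multichoose x).
Proof.
split=> [|k]; first exact: multichoose0.
(* Reversed, the sum runs over [multichoose x j] for [j < k], so that induction on [k] adds one
   term. *)
rewrite (reindex_inj rev_ord_inj) /=.
under eq_bigr => j _ do rewrite subnSK // subKn ?(ltnW (ltn_ord j)) //.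
elim: k => [|k IHk]; first by rewrite big_ord0 mul0r.
by rewrite big_ord_recr /= -IHk multichooseS; ring.
Qed.

Lemma sum_multiples (V : nmodType) p k (H : nat -> V) : (0 < p)%N ->
  \sum_(0 <= i < k.+1 | (p %| i)%N) H i = \sum_(0 <= j < (k %/ p).+1) H (p * j)%N.
Proof.
move=> p_gt0; rewrite -big_filter -[RHS](big_map (muln p) xpredT); apply: perm_big.
apply: uniq_perm => [||i].
- by rewrite filter_uniq ?iota_uniq.
- rewrite map_inj_uniq ?iota_uniq // => i j /eqP.
  by rewrite eqn_pmul2l // => /eqP.
rewrite mem_filter mem_index_iota leq0n ltnS.
apply/andP/mapP => [[/dvdnP[j ->] le_k]|[j + ->]].
  by exists j; rewrite 1?mulnC // mem_index_iota leq0n ltnS leq_divRL.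
rewrite mem_index_iota leq0n ltnS => le_j.
by rewrite dvdn_mulr // mulnC -leq_divRL.
Qed.

(** The coefficient of t^k in (1 - t^p)^(-x). *)
Definition dilate p x k := if (p %| k)%N then multichoose x (k %/ p) else 0.

Lemma newton_dilate p x : (0 < p)%N ->
  newton (fun j => (p %| j)%N%:R * (p%:R * x)) (dilate p x).
Proof.
move=> p_gt0; split=> [|k]; first by rewrite /dilate dvdn0 div0n multichoose0.
(* The index 0 is added and subtracted again so that the sum over multiples of [p] can be
   reindexed. *)
pose H i := (p %| i)%N%:R * (p%:R * x) * dilate p x (k - i)%N.
have -> : \sum_(j < k) (p %| j.+1)%N%:R * (p%:R * x) * dilate p x (k - j.+1) =
          \sum_(0 <= i < k.+1 | (p %| i)%N) H i - H 0%N.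
  rewrite [in RHS]big_mkcond big_nat_recl //= dvdn0 [H 0%N + _]addrC addrK big_mkord.
  by apply: eq_bigr => j _; rewrite /H; case: (p %| _)%N; rewrite ?mul0r.
rewrite sum_multiples // big_nat_recl // muln0 [H 0%N + _]addrC addrK big_mkord.
rewrite {1}/dilate; case: ifP => [dvd_pk|ndvd_pk]; last first.
  rewrite mulr0 big1 // => j _; rewrite /H /dilate dvdn_subl ?dvdn_mulr ?ndvd_pk ?mulr0 //.
  by rewrite mulnC -leq_divRL.
rewrite -{1}(divnK dvd_pk) natrM mulrAC (newton_multichoose x).2 mulr_suml.
apply: eq_bigr => j _; rewrite /H /dilate dvdn_mulr // mul1r dvdn_sub ?dvdn_mulr //.
have -> : (k - p * j.+1 = (k %/ p - j.+1) * p)%N.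
  by rewrite mulnBl divnK // mulnC.
by rewrite mulnK //; ring.
Qed.

(** B_k is the coefficient of t^k in (1 - t^p)^(-aq/p) (1 - t)^(-b). The separate case [b = 0] fits
    because (1 - t)^0 has no terms of positive degree. *)
Lemma BcoefE p q k a b : (0 < p)%N ->
  Bcoef p q k a b =
  \sum_(i < k.+1) dilate p (a * q%:R / p%:R) i * multichoose b (k - i)%N.
Proof.
move=> p_gt0; set x := a * _ / _; rewrite /Bcoef; case: eqVneq => [->|_].
  rewrite big_ord_recr /= subnn multichoose0 mulr1 big1 ?add0r // => i _.
  by rewrite /= -(subnSK (ltn_ord i)) multichoose0S mulr0.
rewrite -(big_mkord xpredT (fun i => dilate p x i * multichoose b (k - i)%N)).
transitivity (\sum_(0 <= i < k.+1 | (p %| i)%N)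
    multichoose x (i %/ p) * multichoose b (k - i)%N).
  by rewrite sum_multiples //; apply: eq_bigr => j _; rewrite mulKn.
by rewrite big_mkcond; apply: eq_bigr => i _; rewrite /dilate; case: ifP; rewrite ?mul0r.
Qed.

Lemma newton_Bcoef p q a b : (0 < p)%N ->
  newton (fun j => b + (p %| j)%N%:R * (q%:R * a)) (fun k => Bcoef p q k a b).
Proof.
move=> p_gt0.
have := newton_conv (newton_dilate (a * q%:R / p%:R) p_gt0) (newton_multichoose b).
apply: newton_eq => [j|k]; last by rewrite BcoefE.
rewrite addrC; congr (_ + _ * _); field.
by rewrite pnatr_eq0 -lt0n.
Qed.

End NewtonRecurrences.

(** * Power sums over irreducible polynomials of fixed degree *)

Section IrreducibleSums.

Variables (F : finFieldType) (p e : nat).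
Hypotheses (p_pr : prime p) (cardF : #|F| = (p ^ e)%N).
Let q := #|F|.

Let q_gt0 : (0 < q)%N.
Proof. by rewrite /q cardF expn_gt0 prime_gt0. Qed.

(** After multiplication by [d], both sides have divisor sums q^m. *)
Lemma card_monic_irr d : (0 < d)%N ->
  #|monic_irr F d|%:R = q%:R * acoef p q d + bcoef p q d :> rat.
Proof.
move=> d_gt0; apply: (mulfI (x := d%:R)); first by rewrite pnatr_eq0 -lt0n.
move: d d_gt0; apply: divisor_sum_inj => m m_gt0; rewrite sum_abcoef //.
rewrite -(irr_power_sum_trivial F rat m_gt0).
by apply: eq_bigr => d _; rewrite irr_sum_trivial.
Qed.

Lemma irr_sum_nontrivial (R : numFieldType) (psi : F -> R) c d j :
    psi 0 = 1 -> {morph psi : x y / x + y >-> x * y} -> psi c != 1 ->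
    (0 < d)%N -> (0 < j)%N ->
  irr_sum psi d j = ratr (bcoef p q d + (p %| j)%N%:R * (q%:R * acoef p q d)).
Proof.
(* The character is generalized because the induction hypothesis is applied to a power of [psi]. *)
elim/ltn_ind: d psi c j => d IHd psi c j psi0 psiD psi_c d_gt0 j_gt0.
have pcharF := card_finPcharP cardF p_pr.
(* In characteristic [p], [psi ^+ j] is trivial when [p] divides [j], and the sum counts
   irreducibles. *)
case: (boolP (p %| j)%N) => [dvd_pj|ndvd_pj].
  rewrite mul1r addrC -card_monic_irr // ratr_nat /irr_sum.
  rewrite (eq_bigr (fun=> 1)) ?sumr_const // => P _.
  rewrite -psiX // -mulr_natl (_ : j%:R = 0) ?mul0r //.
  by apply/eqP; rewrite -(dvdn_pcharf pcharF).
rewrite mul0r addr0.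
have nz_j : j%:R != 0 :> F by rewrite -(dvdn_pcharf pcharF).
(* Otherwise [j] is invertible in [F] and [chi] is again a nontrivial character, as seen at
   [c / j%:R]; this reduces to exponent 1. *)
pose chi x := psi x ^+ j.
have chi0 : chi 0 = 1 by rewrite /chi psi0 expr1n.
have chiD : {morph chi : x y / x + y >-> x * y}.
  by move=> x y; rewrite /chi psiD exprMn.
have chi_c : chi (c / j%:R) != 1 by rewrite /chi -psiX // -(mulr_natr (c / _)) divfK.
have -> : irr_sum psi d j = irr_sum chi d 1 by [].
(* Two vanishing divisor sums are compared. Their terms at a proper divisor [k] agree by induction
   for [chi] with exponent [d %/ k], leaving the terms at [d], of exponent 1. *)
have := irr_power_sum_nontrivial chi0 chiD chi_c d_gt0.
have := congr1 (@ratr R) (sum_bcoef p_pr q_gt0 d_gt0).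
have d_in : d \in divisors d by rewrite -dvdn_divisors.
rewrite rmorph0 rmorph_sum /irr_power_sum (big_rem d d_in) /=.
rewrite [in X in _ -> X -> _](big_rem d d_in) /= divnn d_gt0.
rewrite dvdn1 (gtn_eqF (prime_gt1 p_pr)) mul0r addr0 rmorphM rmorph_nat.
move=> sum_b sum_irr; have := etrans sum_irr (esym sum_b).
rewrite (@eq_big_seq _ _ _ _ _ _ (fun k => @ratr R (k%:R * (bcoef p q k +
  (p %| d %/ k)%N%:R * (q%:R * acoef p q k))))) => [/addIr/mulfI eq_irr|k].
  by apply: eq_irr; rewrite pnatr_eq0 -lt0n.
rewrite mem_rem_uniq ?divisors_uniq // inE -dvdn_divisors // => /andP[neq_k dvd_kd].
have k_gt0 := dvdn_gt0 d_gt0 dvd_kd.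
rewrite (IHd k _ chi (c / j%:R)) //.
- by rewrite rmorphM rmorph_nat.
- by rewrite ltn_neqAle neq_k dvdn_leq.
by rewrite divn_gt0 // dvdn_leq.
Qed.

End IrreducibleSums.

(** * Additive characters as irreducible characters of the group (F, +) *)

Section AdditiveCharacters.

Variable F : finFieldType.
Let G := [set: F]%G.
Implicit Types (i : Iirr G) (x y : F).

Let lin_chi i : 'chi_i \is a linear_char.
Proof. exact/char_abelianP/FinRing.zmod_abelian. Qed.

Lemma add_char0 i : 'chi_i (0 : F) = 1.
Proof. exact: lin_char1. Qed.

Lemma add_charD i : {morph 'chi_i : x y / (x : F) + y >-> x * y}.
Proof. by move=> x y; rewrite -FinRing.zmodMgE lin_charM ?inE. Qed.

Lemma add_char_trivial x : 'chi[G]_0 x = 1.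
Proof. by rewrite irr0 cfun1E inE. Qed.

Lemma add_char_nontrivial i : i != 0 -> exists c : F, 'chi_i c != 1.
Proof.
move=> nz_i; apply/existsP; apply: contraR nz_i => /existsPn chi1.
apply/eqP/irr_inj/cfunP => x; rewrite add_char_trivial.
by apply/eqP; have := chi1 x; rewrite negbK.
Qed.

(** Second orthogonality in an abelian group: conjugacy classes are singletons and centralizers are
    the whole group. *)
Lemma add_char_orthogonal x y :
  \sum_i 'chi[G]_i x * ('chi_i y)^* = #|F|%:R * (x == y)%:R.
Proof.
have abG : abelian G by apply: FinRing.zmod_abelian.
rewrite second_orthogonality_relation ?inE //.
rewrite (abelian_classP _ abG) ?inE // mulr_natr; congr (_%:R *+ _).
rewrite -cardsT; apply: eq_card => z; rewrite in_setI !in_setT.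
by apply/cent1P; rewrite /commute !FinRing.zmodMgE addrC.
Qed.

End AdditiveCharacters.

(** * Counting smooth polynomials by factorization type *)

Lemma monic_splitP (F : finFieldType) m (alpha : F) (f : {poly F}) :
    (0 < m)%N -> f \is monic ->
  [exists g : {poly_m.-1 F}, f == 'X^m + alpha *: 'X^(m.-1) + (g : {poly F})]
  = (size f == m.+1) && (f`_(m.-1) == alpha).
Proof.
move=> m_gt0 mf; apply/existsP/andP => [[g /eqP ->]|[/eqP sf /eqP f_m]].
  have sg : (size (alpha *: 'X^(m.-1) + polyn g)%R <= m)%N.
    rewrite (leq_trans (size_polyD _ _)) // geq_max.
    rewrite (leq_trans (size_scale_leq _ _)) ?size_polyXn ?prednK //=.
    by rewrite (leq_trans (size_npoly _)) // leq_pred.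
  rewrite -addrA size_polyDl ?size_polyXn ?ltnS // eqxx; split=> //.
  rewrite addrA !coefD coefZ !coefXn eqxx (ltn_eqF (_ : (m.-1 < m)%N)) ?prednK //.
  by rewrite add0r mulr1 nth_default ?addr0 // size_npoly.
exists (npolyp m.-1 (f - 'X^m - alpha *: 'X^(m.-1))).
rewrite npolypK; first by apply/eqP; rewrite [RHS]addrC -[f - _ - _]addrA -opprD subrK.
apply/leq_sizeP => j le_j; rewrite !coefB coefZ !coefXn.
have [->|neq_j] := eqVneq j m.-1.
  by rewrite f_m (ltn_eqF (_ : (m.-1 < m)%N)) ?prednK // mulr1 subr0 subrr.
rewrite mulr0 subr0; have [->|neq_jm] := eqVneq j m.
  by have /monicP := mf; rewrite lead_coefE sf => ->; rewrite subrr.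
rewrite subr0 nth_default // sf ltn_neqAle eq_sym neq_jm.
by rewrite -(prednK m_gt0) ltn_neqAle eq_sym neq_j.
Qed.

Section Smooth.

Variables (F : finFieldType) (m n : nat) (alpha : F).
Hypothesis m_gt0 : (0 < m)%N.

Lemma smooth_countE :
  smooth_count m n alpha =
    (\sum_(l in weight_tuples m n) Nstar m (fun i => l i : nat) alpha)%N.
Proof.
(* For monic [f] of degree [m] each count is at most [m], so [inord] returns it unchanged. *)
pose type (f : {poly_m.+1 F}) :=
  [ffun i : 'I_n => inord (irr_factors i.+1 f) : 'I_m.+1].
have typeE (f : {poly_m.+1 F}) i : polyn f \is monic -> size f = m.+1 ->
    type f i = irr_factors i.+1 f :> nat.
  move=> mf sf; rewrite ffunE inordK // ltnS.
  have := factor_weight_leq n mf; rewrite sf /=; apply: leq_trans.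
  by rewrite /factor_weight (bigD1 i) //= (leq_trans _ (leq_addr _ _)) // leq_pmull.
have weightE (f : {poly_m.+1 F}) : polyn f \is monic -> size f = m.+1 ->
    smooth n f = (type f \in weight_tuples m n).
  move=> mf sf; rewrite smooth_factor_weight // sf inE /factor_weight.
  by under [in RHS]eq_bigr => i _ do rewrite typeE //.
rewrite /smooth_count -sum1_card.
rewrite (partition_big type (mem (weight_tuples m n))) => [|f] /=; last first.
  rewrite inE => /and3P[mf smf]; rewrite monic_splitP // => /andP[/eqP sf _].
  by rewrite -weightE.
apply: eq_bigr => l l_in; rewrite sum1_card; apply: eq_card => f.
rewrite unfold_in /= !inE; have [mf|_] := boolP (polyn f \is monic); last by [].
rewrite !andTb monic_splitP //; have [sf|] := eqVneq (size f) m.+1; last by rewrite !andbF.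
case: eqP => _; rewrite ?andbF //= andbT; apply/andP/forallP => [[_ /eqP <-] i|lE].
  exact/eqP/esym/typeE.
have tE : type f = l by apply/ffunP => i; exact/val_inj/(etrans (typeE f i mf sf))/eqP/lE.
by rewrite weightE // tE.
Qed.

Variables (p e : nat).
Hypotheses (p_pr : prime p) (cardF : #|F| = (p ^ e)%N).

(** Fourier inversion over (F, +), multiplied by q. The sums are computed in [algC], and the
    identity descends because [ratr] is injective. *)
Lemma NstarE (l : 'I_n -> nat) : type_degree l = m ->
  #|F|%:R * (Nstar m l alpha)%:R =
    \prod_(i < n) multichoose #|monic_irr F i.+1|%:R (l i) +
    vchar alpha * \prod_(i < n) Bcoef p #|F| (l i) (acoef p #|F| i.+1) (bcoef p #|F| i.+1)
    :> rat.
Proof.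
move=> l_deg; pose C := \prod_(i < n) multichoose #|monic_irr F i.+1|%:R (l i).
pose B := \prod_(i < n) Bcoef p #|F| (l i) (acoef p #|F| i.+1) (bcoef p #|F| i.+1).
pose S (i : Iirr [set: F]) := monic_sum 'chi_i m.+1 m (has_type l).
have S0 : S 0 = ratr C.
  rewrite /S -{2}l_deg (@type_sum_prod _ _ _ _ _ _
    (fun (i : 'I_n) k => ratr (multichoose #|monic_irr F i.+1|%:R k))).
  - by rewrite rmorph_prod.
  - exact: add_char0.
  - exact: add_charD.
  - move=> i; apply: newton_eq (newton_morph (@ratr algC) (newton_multichoose _)) => // j.
    rewrite /= ratr_nat /irr_sum (eq_bigr (fun=> 1)) ?sumr_const // => P _.
    by rewrite add_char_trivial expr1n.
  by rewrite l_deg.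
have SB i : i != 0 -> S i = ratr B.
  move=> nz_i; have [c chi_c] := add_char_nontrivial nz_i.
  rewrite /S -{2}l_deg (@type_sum_prod _ _ _ _ _ _ (fun (i : 'I_n) k =>
    ratr (Bcoef p #|F| k (acoef p #|F| i.+1) (bcoef p #|F| i.+1)))).
  - by rewrite rmorph_prod.
  - exact: add_char0.
  - exact: add_charD.
  - move=> k; have [h0 hE] := newton_morph (@ratr algC)
      (newton_Bcoef #|F| (acoef p #|F| k.+1) (bcoef p #|F| k.+1) (prime_gt0 p_pr)).
    split=> // s; rewrite [LHS]hE; apply: eq_bigr => j _; congr (_ * _).
    by rewrite (irr_sum_nontrivial p_pr cardF (add_char0 i) (@add_charD _ i) chi_c).
  by rewrite l_deg.
apply: (fmorph_inj (@ratr algC)); rewrite rmorphM rmorphD rmorphM !rmorph_nat.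
have conj_sum : \sum_(i : Iirr [set: F]) ('chi_i alpha)^* = ratr (vchar alpha + 1).
  have := add_char_orthogonal 0 alpha.
  under eq_bigr => i _ do rewrite add_char0 mul1r.
  by move=> ->; rewrite /vchar subrK rmorphM !rmorph_nat eq_sym.
(* Orthogonality keeps the [f] with [subcoef f = alpha]; as [m > 0], [subcoef f] is the coefficient
   of index [m.-1]. *)
transitivity (\sum_i ('chi_i alpha)^* * S i).
  rewrite /S; under eq_bigr => i _ do rewrite mulr_sumr.
  rewrite exchange_big /= /Nstar -sum1_card natr_sum mulr_sumr.
  rewrite big_mkcond [RHS]big_mkcond; apply: eq_bigr => f _.
  rewrite inE; case: (polyn f \is monic) => //=.
  case: eqVneq => //= sf; rewrite -/(has_type l (polyn f)).
  case: (has_type l _); rewrite ?andbF // andbT mulr1.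
  under eq_bigr => i _ do rewrite mulrC.
  rewrite add_char_orthogonal /subcoef sf /= coefXM (gtn_eqF m_gt0).
  by case: eqP; rewrite ?mulr1 ?mulr0.
rewrite (bigD1 0) //= S0 add_char_trivial rmorph1 mul1r; congr (_ + _).
under eq_bigr => i nz_i do rewrite SB //.
rewrite -mulr_suml; congr (_ * _).
(* Over all characters the conjugates sum to v(alpha) + 1; the trivial one accounts for the 1. *)
move: conj_sum; rewrite (bigD1 0) //= add_char_trivial rmorph1 rmorphD rmorph1.
by rewrite addrC => /addIr.
Qed.

End Smooth.

Theorem corollary20 (F : finFieldType) (p e : nat) (p_pr : prime p)
    (e_gt0 : (0 < e)%N) (cardF : #|F| = (p ^ e)%N)
    (m n : nat) (m_gt0 : (0 < m)%N) (n_gt0 : (0 < n)%N) (alpha : F) :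
  smooth_count m n alpha
    = (\sum_(l in weight_tuples m n) Nstar m (fun i => l i : nat) alpha)%N
  /\
  ((\sum_(l in weight_tuples m n) Nstar m (fun i => l i : nat) alpha)%N)%:R
    = #|F|%:R ^+ (m - 1) *
        (\sum_(l in weight_tuples m n)
           \prod_(i < n)
             (gbinom (#|monic_irr F i.+1|%:R + (l i)%:R - 1) (l i) *
              #|F|%:R ^- (i.+1 * l i)))
      + vchar alpha / #|F|%:R *
        (\sum_(l in weight_tuples m n)
           \prod_(i < n)
             Bcoef p #|F| (l i) (acoef p #|F| i.+1) (bcoef p #|F| i.+1))
    :> rat.
Proof.
split; first exact: smooth_countE.
have nz_q : #|F|%:R != 0 :> rat.
  by rewrite pnatr_eq0 cardF -lt0n expn_gt0 prime_gt0.
rewrite natr_sum !mulr_sumr -big_split; apply: eq_bigr => l /=.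
rewrite inE => /eqP l_deg; apply: (mulfI nz_q).
rewrite (NstarE alpha m_gt0 p_pr cardF l_deg) mulrDr; congr (_ + _); last first.
  by rewrite mulrA mulrCA mulfV // mulr1.
(* The powers of q in the product multiply to q^(-m), which cancels q times q^(m-1). *)
rewrite [in RHS]big_split /= prodfV prodrXr l_deg mulrA -exprS.
by rewrite subn1 prednK // mulrCA mulfV ?mulr1 // expf_neq0.
Qed.
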